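(* Let $n$ and $i$ be integers with $0 \leq i \leq n$. For each integer $m\ge 0$, let $C_{i,n}(m)$ be the number of $(n+1)$-coloured partitions of $m$ in $\mathcal{C}_n$ such that the last part is $0_{c_i}$ and the penultimate part has colour different from $c_i$. Let $C_{i,n}^{\geq}(m)$ be the number of $(n+1)$-coloured partitions of $m$ in $\mathcal{C}_n^{\geq}$ such that the last part is $0_{c_i}$ and the penultimate part is different from $0_{c_i}$. Then the following identities of formal power series in $q$ hold: $$\sum_{m\geq 0} C_{i,n}(m)q^m = \frac{(q^{i+1},q^{n-i+1},q^{n+2};q^{n+2})_\infty}{(q;q^2)_\infty(q;q)_\infty},$$ $$\sum_{m\geq 0} C_{i,n}^{\geq}(m)q^m = \frac{(q^{i+1},q^{n-i+1},q^{n+2};q^{n+2})_\infty}{(q;q^2)_\infty(q;q)^2_\infty}.$$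
   Context: For $N\in\mathbb{N}\cup\{\infty\}$, $(a;q)_N := \prod_{k=0}^{N-1}(1-aq^k)$ and $(a_1,\dots,a_j;q)_N := (a_1;q)_N\cdots(a_j;q)_N$. Let $n\ge 0$ be an integer and let $c_0,c_1,\dots,c_n$ be $n+1$ colours. An $(n+1)$-coloured part is a non-negative integer $k$ together with a colour $c_u$, written $k_{c_u}$. $\mathcal{C}_n$ denotes the set of finite non-empty sequences $(\lambda_1,\dots,\lambda_s)$ of coloured parts, $\lambda_j$ having colour $c_{u_j}$, such that (comparing the integer values of the parts) $\lambda_j-\lambda_{j+1}=|u_j-u_{j+1}|$ for all $1\le j\le s-1$. $\mathcal{C}_n^{\geq}$ denotes the set of such sequences satisfying instead $\lambda_j-\lambda_{j+1}\geq|u_j-u_{j+1}|$ for all $1\le j\le s-1$. Such a sequence is a coloured partition of $m$ if the sum of the integer values of its parts is $m$. The last part is $\lambda_s$ and the penultimate part is $\lambda_{s-1}$; for the one-term sequence $(0_{c_i})$ there is no penultimate part, the condition on it is vacuous, and this sequence is counted (with $m=0$). *)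

(* Defs.v *)
From HB Require Import structures.
From mathcomp Require Import all_boot all_order all_algebra finmap.
From mathcomp Require Import zify.
From mathcomp Require Import mathcomp_extra boolp classical_sets functions.
From mathcomp Require Import cardinality.

Set Implicit Arguments.
Unset Strict Implicit.
Unset Printing Implicit Defensive.

Import Order.TTheory GRing.Theory Num.Theory.

Local Open Scope ring_scope.
Local Open Scope classical_set_scope.

(* Formal power series. A record rather than a bare function type, so that the
   Cauchy product does not clash with the pointwise ring of functions. *)
Record fps (R : Type) := Fps { fcoef : nat -> R }.

Lemma fpsP (R : Type) (f g : fps R) : fcoef f =1 fcoef g -> f = g.
Proof. by case: f g => [f] [g] /= /funext ->. Qed.

HB.instance Definition _ (R : Type) := gen_eqMixin (fps R).
HB.instance Definition _ (R : Type) := gen_choiceMixin (fps R).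

Section FpsRing.
Variable R : comNzRingType.
Implicit Types f g h : fps R.

Definition fps0 : fps R := Fps (fun _ => 0).
Definition fps_add f g := Fps (fun m => fcoef f m + fcoef g m).
Definition fps_opp f := Fps (fun m => - fcoef f m).
Definition fps1 : fps R := Fps (fun m => (m == 0%N)%:R).
Definition fps_mul f g :=
  Fps (fun m => \sum_(j < m.+1) fcoef f j * fcoef g (m - j)).

Fact fps_addA : associative fps_add.
Proof. by move=> f g h; apply: fpsP => m /=; rewrite addrA. Qed.
Fact fps_addC : commutative fps_add.
Proof. by move=> f g; apply: fpsP => m /=; rewrite addrC. Qed.
Fact fps_add0 : left_id fps0 fps_add.
Proof. by move=> f; apply: fpsP => m /=; rewrite add0r. Qed.
Fact fps_addN : left_inverse fps0 fps_opp fps_add.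
Proof. by move=> f; apply: fpsP => m /=; rewrite addNr. Qed.

HB.instance Definition _ :=
  GRing.isZmodule.Build (fps R) fps_addA fps_addC fps_add0 fps_addN.

Let trunc N f : {poly R} := \poly_(j < N) fcoef f j.

Let coef_trunc_mul N f g m : (m < N)%N ->
  (trunc N f * trunc N g)`_m = fcoef (fps_mul f g) m.
Proof.
move=> mN; rewrite coefM /=; apply: eq_bigr => j _; rewrite !coef_poly.
by rewrite (leq_ltn_trans _ mN) ?leq_ord// (leq_ltn_trans _ mN) ?leq_subr.
Qed.

Fact fps_mulC : commutative fps_mul.
Proof.
by move=> f g; apply: fpsP => m; rewrite -!(@coef_trunc_mul m.+1)// mulrC.
Qed.

Fact fps_mulA : associative fps_mul.
Proof.
move=> f g h; apply: fpsP => m; pose t := trunc m.+1.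
have -> : fcoef (fps_mul f (fps_mul g h)) m = (t f * (t g * t h))`_m.
  rewrite coefM; apply: eq_bigr => j _; rewrite coef_poly ltn_ord.
  by rewrite coef_trunc_mul ?ltnS ?leq_subr.
rewrite mulrA [RHS]/= coefM; apply: eq_bigr => j _; rewrite [X in _ * X]coef_poly.
by rewrite ltnS leq_subr coef_trunc_mul.
Qed.

Fact fps_mul1 : left_id fps1 fps_mul.
Proof.
move=> f; apply: fpsP => m /=; rewrite big_ord_recl /= mul1r subn0.
by rewrite big1 ?addr0// => j _; rewrite mul0r.
Qed.

Fact fps_mulD : left_distributive fps_mul fps_add.
Proof.
move=> f g h; apply: fpsP => m /=; rewrite -big_split /=.
by apply: eq_bigr => j _; rewrite mulrDl.
Qed.

Fact fps1_neq0 : fps1 != fps0.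
Proof.
by apply/eqP => /(congr1 (fun f => fcoef f 0)) /= /eqP; rewrite oner_eq0.
Qed.

HB.instance Definition _ := GRing.Zmodule_isComNzRing.Build (fps R)
  fps_mulA fps_mulC fps_mul1 fps_mulD fps1_neq0.

Definition fps_unit : {pred fps R} := [pred f | `[< exists g, g * f = 1 >]].
Definition fps_inv f := xget f [set g | g * f = 1].

Fact fps_mulVx : {in fps_unit, left_inverse 1 fps_inv *%R}.
Proof. by move=> f; rewrite inE; apply: (@xgetPex _ f [set g | g * f = 1]). Qed.
Fact fps_unitPl f g : g * f = 1 -> f \in fps_unit.
Proof. by move=> gf1; rewrite inE; exists g. Qed.
Fact fps_inv_out : {in [predC fps_unit], fps_inv =1 id}.
Proof.
move=> f; rewrite !inE => /asboolPn nf.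
by apply: xgetPN => g gf1; apply: nf; exists g.
Qed.

HB.instance Definition _ := GRing.ComNzRing_hasMulInverse.Build (fps R)
  fps_mulVx fps_unitPl fps_inv_out.

Definition fpsX : fps R := Fps (fun m => (m == 1%N)%:R).

(* Coefficientwise limit: the m-th coefficient is the eventual value of
   the m-th coefficients (and 0 if they are not eventually constant). *)
Definition fps_lim (u : nat -> fps R) : fps R :=
  Fps (fun m => xget 0 [set c | exists N0, forall N,
    (N0 <= N)%N -> fcoef (u N) m = c]).

Definition qpoch (a q : fps R) (N : nat) : fps R :=
  \prod_(0 <= k < N) (1 - a * q ^+ k).

Definition qpoch_inf (a q : fps R) : fps R := fps_lim (qpoch a q).

Definition qpochs_inf (s : seq (fps R)) (q : fps R) : fps R :=
  \prod_(a <- s) qpoch_inf a q.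

Lemma fcoefD f g m : fcoef (f + g) m = fcoef f m + fcoef g m.
Proof. by []. Qed.

Lemma fcoefN f m : fcoef (- f) m = - fcoef f m.
Proof. by []. Qed.

Lemma fcoef1 m : fcoef (1 : fps R) m = (m == 0%N)%:R.
Proof. by []. Qed.

Lemma fcoefM f g m :
  fcoef (f * g) m = \sum_(j < m.+1) fcoef f j * fcoef g (m - j).
Proof. by []. Qed.

Lemma fcoefX m : fcoef fpsX m = (m == 1%N)%:R.
Proof. by []. Qed.

Lemma fcoefXM f m : fcoef (fpsX * f) m = if m is m'.+1 then fcoef f m' else 0.
Proof.
case: m => [|m]; first by rewrite fcoefM big_ord1 fcoefX mul0r.
rewrite fcoefM big_ord_recl fcoefX mul0r add0r big_ord_recl fcoefX mul1r.
by rewrite big1 ?addr0 ?subSS ?subn0// => j _; rewrite fcoefX mul0r.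
Qed.

Lemma fcoefXnM f k m :
  fcoef (fpsX ^+ k * f) m = if (m < k)%N then 0 else fcoef f (m - k).
Proof.
elim: k m => [|k IHk] m; first by rewrite expr0 mul1r subn0.
by rewrite exprS -mulrA fcoefXM; case: m => [//|m]; rewrite IHk.
Qed.

Lemma fps_limE (u : nat -> fps R) m N0 :
    (forall N, (N0 <= N)%N -> fcoef (u N) m = fcoef (u N0) m) ->
  fcoef (fps_lim u) m = fcoef (u N0) m.
Proof.
move=> uN0; rewrite /=; set A := [set c | _].
have [N1 uN1] : A (xget 0 A) by apply: xgetPex; exists (fcoef (u N0) m), N0.
by rewrite -(uN1 (maxn N0 N1)) ?leq_maxr// uN0 ?leq_maxl.
Qed.

(* (X^a.+1; X^b.+1)_N is coefficientwise eventually constant, so the limit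
   is the expected infinite product. *)
Lemma fcoef_qpoch_inf a b m N : (m <= N)%N ->
  fcoef (qpoch_inf (fpsX ^+ a.+1) (fpsX ^+ b.+1)) m =
  fcoef (qpoch (fpsX ^+ a.+1) (fpsX ^+ b.+1) N) m.
Proof.
set u := qpoch _ _ => mN.
have stab K : (m <= K)%N -> fcoef (u K.+1) m = fcoef (u K) m.
  move=> mK.
  have -> : u K.+1 = u K * (1 - fpsX ^+ a.+1 * fpsX ^+ b.+1 ^+ K).
    by rewrite /u /qpoch big_nat_recr.
  rewrite mulrBr mulr1 -exprM -exprD.
  rewrite fcoefD fcoefN [_ * fpsX ^+ _]mulrC fcoefXnM ifT ?subr0//.
  by rewrite mulSn addSn ltnS; lia.
have um K : (m <= K)%N -> fcoef (u K) m = fcoef (u m) m.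
  by elim: K => [|K IHK]; [case: (m)|
    rewrite leq_eqVlt => /predU1P[->//|mK]; rewrite stab ?IHK].
by rewrite /qpoch_inf (@fps_limE _ _ m) ?um.
Qed.

End FpsRing.

Section FpsUnit.
Variable R : comUnitRingType.

Fixpoint fps_inv_seq (f : fps R) (m : nat) : seq R :=
  if m is m'.+1 then
    let s := fps_inv_seq f m' in
    rcons s ((fcoef f 0)^-1 *
      ((m' == 0%N)%:R - \sum_(j < m') s`_j * fcoef f (m' - j)))
  else [::].

Lemma fps_unitE (f : fps R) :
  (f \is a GRing.unit) = (fcoef f 0 \is a GRing.unit).
Proof.
apply/idP/idP => [/unitrPr[g fg1]|f0].
  by apply/unitrPr; exists (fcoef g 0); rewrite -[RHS](fcoef1 R 0) -fg1
    fcoefM big_ord1.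
pose g := Fps (fun m => (fps_inv_seq f m.+1)`_m).
have sz m : size (fps_inv_seq f m) = m by elim: m => //= m IH; rewrite size_rcons IH.
have nthg m j : (j < m)%N -> (fps_inv_seq f m)`_j = fcoef g j.
  elim: m => // m IHm; rewrite ltnS leq_eqVlt => /predU1P[->//|jm].
  by rewrite /= nth_rcons sz jm IHm.
apply/unitrPr; exists g; rewrite mulrC; apply: fpsP => m.
rewrite fcoefM big_ord_recr /= subnn.
rewrite nth_rcons sz ltnn eqxx.
rewrite [X in _ + X]mulrC mulVKr//.
rewrite (eq_bigr (fun j : 'I_m => (fps_inv_seq f m)`_j * fcoef f (m - j))).
  by rewrite addrC subrK.
by move=> j _; rewrite (nthg m)//.
Qed.

Lemma qpoch_inf_unit a b :
  qpoch_inf (fpsX R ^+ a.+1) (fpsX R ^+ b.+1) \is a GRing.unit.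
Proof.
by rewrite fps_unitE (@fcoef_qpoch_inf _ _ _ _ 0)// /qpoch big_geq// unitr1.
Qed.

End FpsUnit.

Section ColouredPartitions.
Local Open Scope nat_scope.
Variable n : nat.

(* (k, u) is the part k of colour c_u. *)
Definition coloured_part : Type := (nat * 'I_n.+1)%type.
Implicit Types (p : coloured_part) (l : seq coloured_part) (i : 'I_n.+1).

Definition colour_gap p p' : int := `|p.2%:Z - p'.2%:Z|%R.

Definition eq_gap : rel coloured_part :=
  fun p p' => (p.1%:Z - p'.1%:Z == colour_gap p p')%R.

Definition ge_gap : rel coloured_part :=
  fun p p' => (p.1%:Z - p'.1%:Z >= colour_gap p p')%R.

Definition calC : set (seq coloured_part) :=
  [set l | l != [::] /\ sorted eq_gap l].

Definition calC_ge : set (seq coloured_part) :=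
  [set l | l != [::] /\ sorted ge_gap l].

Definition weight l : nat := \sum_(p <- l) p.1.

Definition last_part l : option coloured_part := onth (rev l) 0.

Definition penultimate_part l : option coloured_part := onth (rev l) 1.

Definition C_set i (m : nat) : set (seq coloured_part) :=
  [set l | [/\ calC l, weight l = m, last_part l = Some (0, i) &
    forall p, penultimate_part l = Some p -> p.2 <> i]].

Definition C_ge_set i (m : nat) : set (seq coloured_part) :=
  [set l | [/\ calC_ge l, weight l = m, last_part l = Some (0, i) &
    forall p, penultimate_part l = Some p -> p <> (0, i)]].

Definition C_num i (m : nat) : nat := #|` fset_set (C_set i m)|.

Definition C_ge_num i (m : nat) : nat := #|` fset_set (C_ge_set i m)|.

(* Both sets are finite, so that fset_set takes its genuine value. *)
Lemma C_set_sub i m : C_set i m `<=` C_ge_set i m.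
Proof.
move=> l [[l0 sl] wl lastl penl]; split=> //.
  by split=> //; apply: sub_sorted sl => p p' /eqP; rewrite /ge_gap => ->.
by move=> p /penl pi pE; apply: pi; rewrite pE.
Qed.

Lemma finite_C_ge_set i m : finite_set (C_ge_set i m).
Proof.
pose emb (x : 'I_m.+1 * 'I_n.+1) : coloured_part := (val x.1, x.2).
pose S k := range (fun t : k.-tuple ('I_m.+1 * 'I_n.+1)%type => map emb t).
apply: (@sub_finite_set _ _ (\bigcup_(k in `I_m.+2) S k)); last first.
  apply: bigcup_finite; first exact: finite_II.
  by move=> k _; apply: finite_image; apply: finite_finset.
move=> l [[l0 sl] wl lastl penl].
have szl : size l <= m.+1.
  case/lastP: l l0 sl wl lastl penl => // l x _.
  rewrite /last_part /penultimate_part rev_rcons /= => sl wl [xE] penl.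
  subst x; case/lastP: l sl wl penl => // l p.
  rewrite rev_rcons /= => sl wl /(_ _ erefl) pN.
  have srt : sorted (fun x y : coloured_part => y.1 <= x.1)
      (rcons (rcons l p) (0, i)).
    by apply: sub_sorted sl => x y; rewrite /ge_gap /colour_gap; lia.
  have p0 : 0 < p.1.
    have : ge_gap p (0, i).
      move: sl; rewrite -!cats1 -catA /= => /cat_sorted2[_] /=.
      by rewrite andbT.
    case: p {sl wl srt} pN => [[|k] u] //= uN; rewrite /ge_gap /colour_gap /=.
    have ui : nat_of_ord u <> nat_of_ord i.
      by move=> ui; apply: uN; congr (_, _); apply: val_inj.
    by lia.
  have all1 : all (fun x : coloured_part => 0 < x.1) (rcons l p).
    move: srt; rewrite -cats1 => /cat_sorted2[srt _].
    elim/last_ind: l p p0 {sl wl pN} srt => [p /= ->//|l x IH p p0 srt].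
    rewrite all_rcons p0 /=; apply: IH.
      apply: leq_trans p0 _; move: srt; rewrite -!cats1 -catA => /cat_sorted2[_].
      by rewrite /= andbT.
    by move: srt; rewrite -cats1 => /cat_sorted2[].
  rewrite size_rcons ltnS -wl /weight -[X in \sum_(_ <- X) _]cats1 big_cat /=.
  apply: leq_trans (leq_addr _ _).
  elim: (rcons l p) all1 => //= x s IHs /andP[x0 /IHs].
  by rewrite big_cons; lia.
have lem x : x \in l -> x.1 <= m.
  by move=> xl; rewrite -wl /weight (big_rem x)//= leq_addr.
exists (size l); first by rewrite /= ltnS.
exists (map_tuple (fun x : coloured_part => (inord x.1, x.2)) (in_tuple l)) => //=.
rewrite -map_comp -[RHS]map_id; apply/eq_in_map => x /lem xm /=.
by rewrite /emb /= inordK ?ltnS//; case: x {xm}.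
Qed.

Lemma finite_C_set i m : finite_set (C_set i m).
Proof. exact: sub_finite_set (@C_set_sub i m) (finite_C_ge_set i m). Qed.

End ColouredPartitions.

(* Main.v *)
(** Read upwards from its last part 0_{c_i} and padded with copies of it, a
    coloured partition is a walk on the colours; the generating functions
    H_L(j) of the walks with L steps satisfy
      H_L(j) = \sum_k q^{L|j-k|} H_{L-1}(k).
    The matrix (x^{|j-k|}) has a tridiagonal inverse, so the recursion can be
    checked locally on the closed form, with N = n + 2,
      (q;q^2)_L H_L(j)
        = \sum_{k in Z} (-1)^k q^{N k(k-1)/2 + k(j+1)} [2L choose L-k]_q.
    Modulo q^{L+1}, the binomials become 1/(q;q)_oo, and the remaining theta
    series is evaluated in the same way from the finite Jacobi triple product
    in base q^N. In the case of inequalities, the step with L steps to go has an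
    additional factor 1/(1 - q^L). *)

Require Import Defs.
From mathcomp Require Import all_boot all_order all_algebra finmap.
From mathcomp Require Import zify ring.
From mathcomp Require Import boolp classical_sets cardinality.

Set Implicit Arguments.
Unset Strict Implicit.
Unset Printing Implicit Defensive.

Import Order.TTheory GRing.Theory Num.Theory.

Local Open Scope ring_scope.

(** * Gaussian binomials in an arbitrary base *)

Section QBinomial.
Variables (R : comNzRingType) (p : R).

(** The q-Pascal rule defines the Gaussian binomials without division, hence over any commutative
    ring. *)
Fixpoint qbin (n k : nat) : R :=
  match n, k with
  | _, 0 => 1
  | 0, _.+1 => 0
  | n'.+1, k'.+1 => qbin n' k' + p ^+ k * qbin n' k
  end.

Arguments qbin : simpl never.

Lemma qbin0 n : qbin n 0 = 1. Proof. by case: n. Qed.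

Lemma qbinS n k : qbin n.+1 k.+1 = qbin n k + p ^+ k.+1 * qbin n k.+1.
Proof. by []. Qed.

Lemma qbin_small n k : (n < k)%N -> qbin n k = 0.
Proof.
elim: n k => [|n IHn] [|k] //; rewrite ltnS => nk.
by rewrite qbinS !IHn ?mulr0 ?addr0 // ltnW.
Qed.

Lemma qbinn n : qbin n n = 1.
Proof. by elim: n => // n IHn; rewrite qbinS IHn qbin_small // mulr0 addr0. Qed.

Lemma qbinSr n k : (k <= n)%N ->
  qbin n.+1 k.+1 = p ^+ (n - k) * qbin n k + qbin n k.+1.
Proof.
elim: n k => [|n IHn] k; first by rewrite leqn0 => /eqP->; rewrite /qbin subnn; ring.
rewrite leq_eqVlt => /predU1P[->|]; first by rewrite !qbinn subnn qbin_small //; ring.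
rewrite ltnS => kn; rewrite qbinS [qbin n.+1 k.+1 in LHS]IHn //.
case: k kn => [|k] kn.
  by rewrite [qbin n.+1 1]qbinS !qbin0 !subn0 !exprS; ring.
rewrite [in LHS](IHn k) 1?ltnW // [qbin n.+1 k.+1]qbinS [qbin n.+1 k.+2 in RHS]qbinS subSS.
have -> : (n - k = (n - k.+1).+1)%N by lia.
by rewrite !exprS; ring.
Qed.

Lemma qbin_sym n k : (k <= n)%N -> qbin n (n - k) = qbin n k.
Proof.
elim: n k => [|n IHn] [|k] //; rewrite ?subn0 ?qbinn ?qbin0 // ltnS subSS.
rewrite leq_eqVlt => /predU1P[->|kn]; first by rewrite subnn qbin0 qbinn.
have nk : (n - k = (n - k.+1).+1)%N by lia.
rewrite {1}nk qbinSr; last by lia.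
rewrite -nk (IHn _ kn) (IHn _ (ltnW kn)) qbinS.
have -> : (n - (n - k.+1) = k.+1)%N by lia.
by rewrite addrC.
Qed.

Lemma qbin_absorb n k :
  qbin n.+1 k.+1 * (1 - p ^+ k.+1) = (1 - p ^+ n.+1) * qbin n k.
Proof.
elim: n k => [|n IHn] [|k]; rewrite ?qbinS.
- by rewrite /qbin; ring.
- by rewrite /qbin; ring.
- by rewrite mulrDl -mulrA IHn !qbin0 !exprS; ring.
rewrite mulrDl -mulrA IHn; have := IHn k; rewrite qbinS => E.
rewrite [p ^+ k.+2]exprS [p ^+ n.+2]exprS.
(* The two sides differ by [p] times the difference of the two sides of [E]. *)
apply: subr0_eq; rewrite -[RHS](mulr0 p) -(subrr ((1 - p ^+ n.+1) * qbin n k)) -{1}E.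
by ring.
Qed.

Lemma qbin_absorbl n k : (k <= n.+1)%N ->
  qbin n.+1 k * (1 - p ^+ (n.+1 - k)) = (1 - p ^+ n.+1) * qbin n k.
Proof.
rewrite leq_eqVlt => /predU1P[->|]; first by rewrite subnn expr0 (@qbin_small n n.+1) //; ring.
rewrite ltnS => kn; rewrite -qbin_sym 1?ltnW // subSn // qbin_absorb qbin_sym //.
Qed.

Lemma qbin_prod n k : (k <= n)%N ->
  qbin n k * (\prod_(0 <= j < k) (1 - p * p ^+ j)
              * \prod_(0 <= j < n - k) (1 - p * p ^+ j))
  = \prod_(0 <= j < n) (1 - p * p ^+ j).
Proof.
elim: n k => [|n IHn] [|k] //; try by rewrite qbin0 mul1r subn0 big_geq ?mul1r.
rewrite ltnS subSS => kn; rewrite !big_nat_recr //= -(IHn k kn) -!exprS.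
by move: (qbin_absorb n k) => E; rewrite [RHS]mulrC !mulrA -E; ring.
Qed.

(* A bilateral q-binomial theorem: the hypothesis is what the terms
   (-1)^k Q^(k(k-1)/2) A^k satisfy when shifted by k = r - b. *)
Lemma qbin_thm (x : R) (s : nat -> R) a b :
    (forall r c, (r <= c + b)%N ->
      - x * p ^+ c * s r = p ^+ (c + b - r) * s r.+1) ->
  \prod_(0 <= k < a) (1 - x * p ^+ k) * \sum_(0 <= r < b.+1) s r * qbin b r
  = \sum_(0 <= r < (a + b).+1) s r * qbin (a + b) r.
Proof.
move=> sE; elim: a => [|a IHa]; first by rewrite big_geq // mul1r add0n.
rewrite big_nat_recr //= [_ * (1 - _)]mulrC -mulrA IHa mulrBl mul1r.
rewrite addSn [RHS]big_nat_recl // qbin0.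
rewrite [X in _ = _ + X](eq_big_nat _ _ (F2 := fun r => s r.+1 * qbin (a + b) r.+1
  + s r.+1 * (p ^+ (a + b - r) * qbin (a + b) r))); last first.
  by move=> r /andP[_ rab]; rewrite qbinSr //; ring.
rewrite big_split /= addrA; congr (_ + _).
  rewrite [LHS]big_nat_recl // qbin0; congr (_ + _).
  by rewrite [RHS]big_nat_recr //= qbin_small // mulr0 addr0.
rewrite -mulNr -[- (x * _)]mulNr mulr_sumr; apply: eq_big_nat => r /andP[_ rab].
by rewrite [LHS]mulrA sE //; ring.
Qed.

End QBinomial.

Arguments qbin : simpl never.

(** * Finite theta sums and their three-term recurrence *)

Section Theta.
Variable R : comNzRingType.
Variable q : R.

(* [theta_exp N J L r] is the exponent N k(k-1)/2 + k J with k = r - L in Z,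
   written for k < 0 so that no cancellation occurs. *)
Definition theta_exp N J L r : nat :=
  (if (r < L)%N then N * 'C(L - r, 2) + (L - r) * (N - J)
   else N * 'C(r - L, 2) + (r - L) * J)%N.

(** The sign is (-1)^k with k = r - L, since L + r has the parity of k. *)
Definition theta_term N J L r : R := (-1) ^+ (L + r) * q ^+ theta_exp N J L r.

Definition theta_sum N J L : R :=
  \sum_(0 <= r < L.*2.+1) theta_term N J L r * qbin q L.*2 r.

(** The reflection k -> -k exchanges J and N - J in the exponent. *)
Lemma theta_term_rev N J L r : (J <= N)%N -> (r <= L.*2)%N ->
  theta_term N J L (L.*2 - r) = theta_term N (N - J) L r.
Proof.
move=> JN rL; rewrite /theta_term.
have -> : theta_exp N J L (L.*2 - r) = theta_exp N (N - J) L r.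
  rewrite /theta_exp; case: ltngtP => rL'.
  - have -> : (r < L)%N = false by lia.
    by have -> : (L - (L.*2 - r) = r - L)%N by lia.
  - have -> : (r < L)%N by lia.
    have -> : (L.*2 - r - L = L - r)%N by lia.
    by rewrite subKn.
  - have -> : r = L by lia.
    have -> : (L.*2 - L - L = 0)%N by lia.
    by rewrite ltnn subnn !mul0n.
by rewrite -signr_odd -[in RHS]signr_odd !oddD oddB // odd_double.
Qed.

(** Raising J by one adds k = r - L to the exponent; the factor q^L keeps all powers nonnegative. *)
Lemma theta_term_succ N J L r : (J < N)%N -> (r <= L.*2)%N ->
  q ^+ L * theta_term N J.+1 L r = q ^+ r * theta_term N J L r.
Proof.
move=> JN rL; rewrite /theta_term mulrCA [RHS]mulrCA -!exprD.
congr (_ * _ ^+ _); rewrite /theta_exp; case: ifP => rL'; last by lia.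
have -> : (N - J = (N - J.+1).+1)%N by lia.
by lia.
Qed.

Lemma theta_term_pred N J L r : (J < N)%N -> (r <= L.*2)%N ->
  q ^+ L * theta_term N J L r = q ^+ (L.*2 - r) * theta_term N J.+1 L r.
Proof.
move=> JN rL; rewrite /theta_term mulrCA [RHS]mulrCA -!exprD.
congr (_ * _ ^+ _); rewrite /theta_exp; case: ifP => rL'; last by lia.
have -> : (N - J = (N - J.+1).+1)%N by lia.
by lia.
Qed.

Lemma theta_termSS N J L r : theta_term N J L.+1 r.+1 = theta_term N J L r.
Proof.
by rewrite /theta_term /theta_exp ltnS !subSS addSn addnS !exprS mulrA mulrNN !mul1r.
Qed.

(** Consecutive terms have ratio -q^(Nk + J), which gives the hypothesis of [qbin_thm] in base
    q^N. *)
Lemma theta_term_step N J L r c : (J <= N)%N -> (r <= c + L)%N ->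
  - q ^+ J * (q ^+ N) ^+ c * theta_term N J L r
  = (q ^+ N) ^+ (c + L - r) * theta_term N J L r.+1.
Proof.
move=> JN rcL; rewrite /theta_term addnS exprS !mulN1r !mulNr mulrN; congr (- _).
rewrite -!exprM mulrCA [RHS]mulrCA -!exprD; congr (_ * _ ^+ _).
rewrite /theta_exp; case: ltngtP rcL => rL rcL.
- have [k kE] : {k | L = (r + k).+1} by exists (L - r.+1)%N; lia.
  have -> : (L - r = k.+1)%N by lia.
  have -> : (c + L - r = c + k.+1)%N by lia.
  have -> : (L - r.+1 = k)%N by lia.
  rewrite kE binS bin1; case: ltnP => rk; first by nia.
  have -> : k = 0%N by lia.
  have -> : (r.+1 - (r + 0).+1 = 0)%N by lia.
  by rewrite !bin0n; nia.
- have [k kE] : {k | r = (L + k)%N} by exists (r - L)%N; lia.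
  have -> : (r - L = k)%N by lia.
  have -> : (r.+1 - L = k.+1)%N by lia.
  have [d dE] : {d | c = (d + k)%N} by exists (c - k)%N; lia.
  have -> : (c + L - r = d)%N by lia.
  rewrite ltnNge ltnW 1?ltnW //= binS bin1 dE; nia.
rewrite rL subnn subSn // subnn addnK ltnNge leqnSn /= (bin_small (n := 1)) // bin0n; lia.
Qed.

Lemma theta_sum0 N J : theta_sum N J 0 = 1.
Proof.
by rewrite /theta_sum big_nat1 /theta_term /theta_exp /= bin0n muln0 !mul1r.
Qed.

Lemma theta_sum_sym N J L : (J <= N)%N -> theta_sum N (N - J) L = theta_sum N J L.
Proof.
move=> JN; rewrite /theta_sum [RHS]big_nat_rev add0n; apply: eq_big_nat => r /andP[_ rL].
by rewrite subSS theta_term_rev // qbin_sym.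
Qed.

(** Expressed through the terms for J + 1, the left side has coefficients (1 - q^r)(1 - q^(2L+2-r)).
    These kill both end terms, and absorbing each factor into the binomial lowers 2L + 2 to 2L. *)
Lemma theta_sum_rec N J L : (J.+1 < N)%N ->
  (1 + q ^+ L.+1.*2) * theta_sum N J.+1 L.+1
  - q ^+ L.+1 * (theta_sum N J L.+1 + theta_sum N J.+2 L.+1)
  = (1 - q ^+ L.+1.*2) * (1 - q ^+ L.*2.+1) * theta_sum N J.+1 L.
Proof.
move=> JN; rewrite /theta_sum mulrDr !mulr_sumr -big_split -sumrB /=.
transitivity (\sum_(0 <= r < L.+1.*2.+1) theta_term N J.+1 L.+1 r *
   (qbin q L.+1.*2 r * (1 - q ^+ r) * (1 - q ^+ (L.+1.*2 - r)))).
  apply: eq_big_nat => r /andP[_ rL].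
  rewrite 2!(mulrA (q ^+ L.+1) (theta_term _ _ _ _)) theta_term_pred // 1?ltnW // theta_term_succ //.
  have -> : q ^+ L.+1.*2 = q ^+ r * q ^+ (L.+1.*2 - r) by rewrite -exprD subnKC.
  by ring.
rewrite doubleS [LHS]big_nat_recl // [X in _ + X]big_nat_recr //=.
rewrite subnn expr0 subrr !mulr0 !mul0r !mulr0 addr0 add0r.
apply: eq_big_nat => r /andP[_ rL].
rewrite theta_termSS qbin_absorb -[_ * qbin _ _ _ * _]mulrA subSS qbin_absorbl; last by lia.
by ring.
Qed.

End Theta.

(** * Boundary relation for the theta sums *)

Section ThetaBoundary.
Variable q : fps int.

Lemma fps_int_eqN (f : fps int) : f = - f -> f = 0.
Proof.
by move=> fN; apply: fpsP => m; have := congr1 (fun g => fcoef g m) fN; rewrite fcoefN /=; lia.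
Qed.

(* The difference is antisymmetric under k -> 1 - k. *)
Lemma theta_sum_bound N L : (0 < N)%N -> theta_sum q N 0 L = q ^+ L * theta_sum q N 1 L.
Proof.
case: L => [|L] N0; first by rewrite !theta_sum0 mulr1.
apply: subr0_eq; rewrite /theta_sum mulr_sumr -sumrB.
rewrite (eq_big_nat _ _ (F2 := fun r => theta_term q N 0 L.+1 r *
  (qbin q L.+1.*2 r * (1 - q ^+ r)))); last first.
  by move=> r /andP[_ rL]; rewrite (mulrA (q ^+ L.+1) (theta_term _ _ _ _ _)) theta_term_succ //; ring.
rewrite big_nat_recl // expr0 subrr !mulr0 add0r doubleS.
under eq_bigr do rewrite qbin_absorb.
apply: fps_int_eqN; rewrite [LHS]big_nat_rev -sumrN add0n.
apply: eq_big_nat => r /andP[_ rL]; rewrite subSS qbin_sym // -[RHS]mulNr; congr (_ * _).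
have -> : theta_term q N 0 L.+1 (L.*2.+1 - r).+1
    = (-1) ^+ (L.+1 + (L.*2.+1 - r).+1) * q ^+ theta_exp N 0 L.+1 r.+1.
  congr (_ * _ ^+ _).
  have expE s : theta_exp N 0 L.+1 s =
      (N * 'C(if s < L.+1 then (L.+1 - s).+1 else s - L.+1, 2))%N.
    by rewrite /theta_exp; case: ifP => _; rewrite ?binS ?bin1; lia.
  rewrite !expE; set a := (if _ then _ else _); set b := (if _ then _ else _).
  (* The indices k and 1 - k give the same entry, except for the pair 0, 1, where both binomials
     vanish. *)
  have [->//|[a2 b2]] : a = b \/ (a < 2 /\ b < 2)%N.
    by rewrite /a /b; case: ifP; case: ifP; lia.
  by rewrite !bin_small.
rewrite -mulNr; congr (_ * _).
rewrite -[RHS]mulN1r -exprS -signr_odd -[RHS]signr_odd.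
by congr ((-1) ^+ nat_of_bool _); lia.
Qed.

End ThetaBoundary.

(** * Inversion of the distance matrix *)

Definition ndist (j k : nat) : nat := (j - k + (k - j))%N.

(* The tridiagonal operator on the right inverts the matrix (x^|j-k|). *)
Lemma sum_expr_ndist (R : comNzRingType) (x : R) (f : nat -> R) n j :
    (j <= n)%N -> f 0%N = x * f 1%N -> f n.+2 = x * f n.+1 ->
  \sum_(0 <= k < n.+1) x ^+ ndist j k *
    ((1 + x ^+ 2) * f k.+1 - x * (f k + f k.+2)) = (1 - x ^+ 2) * f j.+1.
Proof.
move=> jn f0 fn; rewrite (big_cat_nat (n := j.+1)) //=.
(* The sum telescopes on each side of j; the conditions on [f 0] and [f n.+2] annihilate the two
   outer ends. *)
have lo a : (a <= j.+1)%N -> \sum_(0 <= k < a) x ^+ ndist j k *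
    ((1 + x ^+ 2) * f k.+1 - x * (f k + f k.+2)) = x ^+ (j.+1 - a) * (f a - x * f a.+1).
  elim: a => [|a IHa] aj; first by rewrite big_geq // f0 subrr mulr0.
  rewrite big_nat_recr //= IHa 1?ltnW // /ndist.
  have -> : (j - a + (a - j) = j - a)%N by lia.
  by rewrite subSS subSn // exprS; ring.
have hi b : (j < b)%N -> \sum_(j.+1 <= k < b) x ^+ ndist j k *
    ((1 + x ^+ 2) * f k.+1 - x * (f k + f k.+2))
    = x * (f j.+2 - x * f j.+1) - x ^+ (b - j) * (f b.+1 - x * f b).
  elim: b => // b IHb; rewrite ltnS leq_eqVlt => /predU1P[<-|jb].
    by rewrite big_geq // subSnn expr1 subrr.
  rewrite big_nat_recr //= IHb // /ndist.
  have -> : (j - b + (b - j) = b - j)%N by lia.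
  by rewrite subSn 1?ltnW // [x ^+ (b - j).+1]exprS; ring.
by rewrite lo // hi // fn subrr mulr0 subnn; ring.
Qed.

(** * Generating functions of walks and their closed form *)

Section WalkSeries.
Variable n : nat.
Local Notation q := (fpsX int).

(* Generating function of the walks of L steps from the part 0_{c_j}, where the
   surplus of each difference over its minimal value is at most D. The step
   made with L steps to go raises L parts, whence the exponents. *)
Fixpoint walk_gf D L j : fps int :=
  if L is L'.+1 then
    (\sum_(0 <= d < D.+1) q ^+ (L * d)) *
    \sum_(0 <= k < n.+1) q ^+ (L * ndist j k) * walk_gf D L' k
  else 1.

(** The surplus factor of a step is independent of the colours, so it can be taken out of the sum
    over the next colour. *)
Lemma walk_gf_surplus D L j :
  walk_gf D L j =
  (\prod_(0 <= l < L) \sum_(0 <= d < D.+1) q ^+ (l.+1 * d)) * walk_gf 0 L j.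
Proof.
elim: L j => [|L IHL] j; first by rewrite big_geq // mul1r.
rewrite big_nat_recr //= big_nat1 muln0 expr0 mul1r [RHS]mulrAC [RHS]mulrC.
congr (_ * _); rewrite mulr_sumr; apply: eq_bigr => k _.
by rewrite IHL mulrCA.
Qed.

Lemma sub1X_unit k : 1 - q ^+ k.+1 \is a GRing.unit.
Proof.
by rewrite fps_unitE fcoefD fcoefN fcoef1 -[q ^+ _]mulr1 fcoefXnM subr0 unitr1.
Qed.

Lemma walk_gf_theta L j : (j <= n)%N ->
  walk_gf 0 L j * qpoch q (q ^+ 2) L = theta_sum q n.+2 j.+1 L.
Proof.
elim: L j => [|L IHL] j jn; first by rewrite theta_sum0 /qpoch big_geq // mulr1.
(* This is the factor 1 - x^2 of [sum_expr_ndist] at x = q^(L+1), to be cancelled. *)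
have u : 1 - q ^+ L.+1.*2 \is a GRing.unit by rewrite doubleS sub1X_unit.
apply: (mulIr u); rewrite [RHS]mulrC -muln2 exprM.
rewrite -(@sum_expr_ndist _ (q ^+ L.+1) (fun J => theta_sum q n.+2 J L.+1) n) //; last first.
(* The symmetry J -> n + 2 - J turns the upper boundary condition into the lower one. *)
- have := theta_sum_sym q L.+1 (leq0n n.+2); rewrite subn0 => ->.
  have := @theta_sum_sym _ q n.+2 1 L.+1 isT; rewrite subSS subn0 => ->.
  exact: theta_sum_bound.
- exact: theta_sum_bound.
rewrite /= big_nat1 muln0 expr0 mul1r !mulr_suml; apply: eq_big_nat => k /andP[_ kn].
rewrite -exprM muln2 theta_sum_rec; last by rewrite ltnS in kn; lia.
rewrite -IHL // /qpoch big_nat_recr //= -!exprM -[q * _]exprS mul2n.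
by rewrite exprM; ring.
Qed.

End WalkSeries.

(** * Congruence of power series modulo X^K *)

Section Congruence.
Implicit Types (f g h : fps int) (K k : nat).

Definition eq_modX K f g := forall m, (m < K)%N -> fcoef f m = fcoef g m.

Lemma eq_modX_trans K f g h : eq_modX K f g -> eq_modX K g h -> eq_modX K f h.
Proof. by move=> fg gh m mK; rewrite fg ?gh. Qed.

Lemma eq_modX_sym K f g : eq_modX K f g -> eq_modX K g f.
Proof. by move=> fg m mK; rewrite fg. Qed.

Lemma eq_modX_refl K f : eq_modX K f f.
Proof. by []. Qed.

Lemma eq_modXW K K' f g : (K <= K')%N -> eq_modX K' f g -> eq_modX K f g.
Proof. by move=> KK' fg m mK; apply: fg; apply: leq_trans mK _. Qed.

Lemma eq_modXD K f f' g g' :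
  eq_modX K f f' -> eq_modX K g g' -> eq_modX K (f + g) (f' + g').
Proof. by move=> ff gg m mK; rewrite !fcoefD ff ?gg. Qed.

Lemma eq_modXM K f f' g g' :
  eq_modX K f f' -> eq_modX K g g' -> eq_modX K (f * g) (f' * g').
Proof.
move=> ff gg m mK; rewrite !fcoefM; apply: eq_bigr => j _.
rewrite ff ?gg ?(leq_ltn_trans _ mK) ?leq_subr // -ltnS ltn_ord //.
Qed.

Lemma eq_modX_sum K a b (F G : nat -> fps int) :
    (forall r, (a <= r < b)%N -> eq_modX K (F r) (G r)) ->
  eq_modX K (\sum_(a <= r < b) F r) (\sum_(a <= r < b) G r).
Proof.
move=> FG; rewrite big_nat [X in eq_modX _ _ X]big_nat.
by apply: (big_ind2 (eq_modX K)) => //; apply: eq_modXD.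
Qed.

Lemma eq_modX_prod K a b (F G : nat -> fps int) :
    (forall r, (a <= r < b)%N -> eq_modX K (F r) (G r)) ->
  eq_modX K (\prod_(a <= r < b) F r) (\prod_(a <= r < b) G r).
Proof.
move=> FG; rewrite big_nat [X in eq_modX _ _ X]big_nat.
by apply: (big_ind2 (eq_modX K)) => //; apply: eq_modXM.
Qed.

Lemma eq_modX_mulXn K k e f g : (K <= k + e)%N -> eq_modX k f g ->
  eq_modX K (fpsX int ^+ e * f) (fpsX int ^+ e * g).
Proof.
by move=> Kke fg m mK; rewrite !fcoefXnM; case: ltnP => // em; rewrite fg //; lia.
Qed.

Lemma eq_modX_unit K u f g : u \is a GRing.unit ->
  eq_modX K (f * u) g -> eq_modX K f (g / u).
Proof.
by move=> uu fg; rewrite -[f](mulrK uu); apply: eq_modXM (eq_modX_refl _).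
Qed.

Lemma eq_modX_unitM K u v f g : u \is a GRing.unit -> v \is a GRing.unit ->
  eq_modX K (f * (u * v)) g -> eq_modX K f (g / (u * v)).
Proof. by move=> uu uv; apply: eq_modX_unit; rewrite unitrM uu uv. Qed.

Lemma eq_modX_unitM_sqr K u v f g : u \is a GRing.unit -> v \is a GRing.unit ->
  eq_modX K (f * v) (g / (u * v)) -> eq_modX K f (g / (u * v ^+ 2)).
Proof.
move=> uu uv /(eq_modX_unit uv); rewrite expr2 mulrA.
by rewrite [(u * v * v)^-1]invrM ?unitrM ?uu ?uv // [v^-1 * _]mulrC mulrA.
Qed.

End Congruence.

(** * Passage from finite sums to infinite products *)

Section Limits.
Local Notation q := (fpsX int).

Lemma qpoch_inf_modX a b K : eq_modX K.+1
  (qpoch_inf (q ^+ a.+1) (q ^+ b.+1)) (qpoch (q ^+ a.+1) (q ^+ b.+1) K).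
Proof. by move=> m mK; apply: fcoef_qpoch_inf. Qed.

(** The binomial is (p;p)_n divided by (p;p)_r (p;p)_{n-r}, and each of these three products agrees
    with the infinite one to the required order. *)
Lemma qbin_modX b n r (p := q ^+ b.+1) : (r <= n)%N ->
  eq_modX (minn r (n - r)).+1 (qbin p n r * qpoch_inf p p) 1.
Proof.
move=> rn; rewrite -(divrr (qpoch_inf_unit int b b)).
apply: eq_modX_unit; first exact: qpoch_inf_unit.
have E := qbin_prod p rn.
apply: (@eq_modX_trans _ _ (qpoch p p n)); last first.
  apply: eq_modXW (eq_modX_sym (@qpoch_inf_modX b b n)); lia.
rewrite /qpoch -E -mulrA; apply: eq_modXM => //; apply: eq_modXM.
  apply: eq_modXW (@qpoch_inf_modX b b r); lia.
apply: eq_modXW (@qpoch_inf_modX b b (n - r)%N); lia.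
Qed.

Lemma theta_exp_ge N J L r : (0 < J < N)%N -> (ndist r L <= theta_exp N J L r)%N.
Proof. by move=> /andP[J0 JN]; rewrite /ndist /theta_exp; case: ifP => rL; nia. Qed.

(** The binomial at r is controlled only to order min(r, 2L-r) + 1, but its theta exponent is at
    least |r - L|, and the two add up to at least L + 1. The limit does not depend on the base [p],
    which allows the change from q to q^N below. *)
Lemma theta_sum_modX b N J L (p := q ^+ b.+1) : (0 < J < N)%N ->
  eq_modX L.+1
    ((\sum_(0 <= r < L.*2.+1) theta_term q N J L r * qbin p L.*2 r) * qpoch_inf p p)
    (\sum_(0 <= r < L.*2.+1) theta_term q N J L r).
Proof.
move=> JN; rewrite mulr_suml; apply: eq_modX_sum => r /andP[_ rL].
rewrite -mulrA -[X in eq_modX _ _ X]mulr1 -!mulrA; apply: eq_modXM => //.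
apply: (@eq_modX_mulXn _ (minn r (L.*2 - r)).+1); last exact: qbin_modX.
have := theta_exp_ge L r JN; rewrite /ndist; lia.
Qed.

(** The finite Jacobi triple product: two uses of [qbin_thm] split off one product each. *)
Lemma theta_sum_prod N J L : (J <= N)%N ->
  \sum_(0 <= r < L.*2.+1) theta_term q N J L r * qbin (q ^+ N) L.*2 r
  = qpoch (q ^+ J) (q ^+ N) L * qpoch (q ^+ (N - J)) (q ^+ N) L.
Proof.
move=> JN; rewrite -addnn -(@qbin_thm _ _ (q ^+ J)); last first.
  by move=> r c rc; apply: theta_term_step.
congr (_ * _).
(* Only terms with k <= 0 are left; reversing the order makes k nonnegative and replaces J by N -
   J. *)
transitivity (\sum_(0 <= r < (L + 0).+1) theta_term q N (N - J) 0 r * qbin (q ^+ N) (L + 0) r).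
  rewrite addn0 big_nat_rev add0n; apply: eq_big_nat => r /andP[_ rL].
  rewrite subSS qbin_sym //; congr (_ * _).
  rewrite /theta_term /theta_exp subn0 subKn //.
  have -> : (L + (L - r) = r + (L - r).*2)%N by lia.
  rewrite exprD -[in X in _ * X * _]mul2n exprM sqrrN expr1n expr1n mulr1.
  rewrite ltn0; case: ltnP => // h; have -> : r = 0%N by lia.
  by rewrite subn0 subnn !bin0n !mul0n.
rewrite -(@qbin_thm _ _ (q ^+ (N - J))); last first.
  by move=> r c rc; apply: theta_term_step => //; lia.
by rewrite big_nat1 /theta_term /theta_exp /= qbin0 !mul0n muln0 !mulr1.
Qed.

(** The sums in base q and in base q^N tend to the same theta series, and the second one is a
    product. *)
Lemma theta_sum_lim N J L : (0 < J < N)%N ->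
  eq_modX L.+1 (theta_sum q N J L * qpoch_inf q q)
    (qpochs_inf [:: q ^+ J; q ^+ (N - J); q ^+ N] (q ^+ N)).
Proof.
case: N => [|N]; first by rewrite ltn0 andbF.
case: J => [//|J] JN; have NJ : (N.+1 - J.+1 = (N.+1 - J.+1).-1.+1)%N by lia.
have := @theta_sum_modX 0 N.+1 J.+1 L JN; rewrite expr1 => /eq_modX_trans; apply.
apply: eq_modX_trans (eq_modX_sym (@theta_sum_modX N N.+1 J.+1 L JN)) _.
rewrite theta_sum_prod; last by lia.
rewrite /qpochs_inf !big_cons big_nil mulr1 mulrA.
apply: eq_modXM => //; rewrite NJ.
by apply: eq_modXM; apply: eq_modX_sym; apply: qpoch_inf_modX.
Qed.

Lemma walk_gf_lim n L j : (j <= n)%N ->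
  eq_modX L.+1 (walk_gf n 0 L j)
   (qpochs_inf [:: q ^+ (j + 1); q ^+ (n - j + 1); q ^+ (n + 2)] (q ^+ (n + 2))
    / (qpoch_inf q (q ^+ 2) * qpoch_inf q q)).
Proof.
move=> jn; have u1 : qpoch_inf q (q ^+ 2) \is a GRing.unit := qpoch_inf_unit int 0 1.
have u2 : qpoch_inf q q \is a GRing.unit := qpoch_inf_unit int 0 0.
apply: (eq_modX_unitM u1 u2).
have := @theta_sum_lim n.+2 j.+1 L; rewrite /= !ltnS jn => /(_ isT).
have -> : (n.+2 - j.+1 = n - j + 1)%N by lia.
rewrite !addn1 addn2 => H; refine (eq_modX_trans _ H); rewrite mulrA -walk_gf_theta //.
apply: eq_modXM => //; apply: eq_modXM => //.
exact: (@qpoch_inf_modX 0 1 L).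
Qed.

(** Each truncated geometric sum times its factor 1 - q^(l+1) is 1 - q^((l+1)(D+1)), which is 1 to
    the stated order. *)
Lemma surplus_modX D L :
  eq_modX D.+1
    ((\prod_(0 <= l < L) \sum_(0 <= d < D.+1) q ^+ (l.+1 * d)) * qpoch q q L) 1.
Proof.
apply: (@eq_modX_trans _ _ (\prod_(0 <= l < L) 1)); last by rewrite big1_eq.
rewrite /qpoch -big_split; apply: eq_modX_prod => l _ /=.
under eq_bigr do rewrite exprM.
rewrite mulrC -exprS.
have -> : (1 - q ^+ l.+1) * (\sum_(0 <= d < D.+1) (q ^+ l.+1) ^+ d) = 1 - q ^+ (l.+1 * D.+1).
  rewrite exprM -[in RHS](expr1n _ D.+1) subrXX big_mkord; congr (_ * _).
  by apply: eq_bigr => d _; rewrite expr1n mul1r.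
move=> m mD; rewrite fcoefD fcoefN -[q ^+ _]mulr1 fcoefXnM.
by rewrite ifT ?subr0 //; nia.
Qed.

Lemma walk_gf_surplus_lim n D L j : (j <= n)%N -> (D <= L)%N ->
  eq_modX D.+1 (walk_gf n D L j)
   (qpochs_inf [:: q ^+ (j + 1); q ^+ (n - j + 1); q ^+ (n + 2)] (q ^+ (n + 2))
    / (qpoch_inf q (q ^+ 2) * qpoch_inf q q ^+ 2)).
Proof.
move=> jn DL; have u1 : qpoch_inf q (q ^+ 2) \is a GRing.unit := qpoch_inf_unit int 0 1.
have u2 : qpoch_inf q q \is a GRing.unit := qpoch_inf_unit int 0 0.
apply: (eq_modX_unitM_sqr u1 u2).
rewrite walk_gf_surplus mulrAC -[X in eq_modX _ _ X]mul1r.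
apply: eq_modXM; last exact: eq_modXW (walk_gf_lim jn).
apply: eq_modX_trans (@surplus_modX D L); apply: eq_modXM => //.
have E : eq_modX L.+1 (qpoch_inf q q) (qpoch q q L) := @qpoch_inf_modX 0 0 L.
exact: eq_modXW E.
Qed.

End Limits.

(** * Coloured partitions as padded walks *)

Section Walks.
Variable n : nat.
Implicit Types (p : coloured_part n) (l : seq (coloured_part n)) (i : 'I_n.+1).

(** Here [p'] precedes [p] in the partition. [D = 0] is the equality condition; a finite [D] keeps
    the walks enumerable in the case of inequalities. *)
Definition gap_le D : rel (coloured_part n) := fun p p' =>
  (p.1 + ndist p.2 p'.2 <= p'.1 <= p.1 + ndist p.2 p'.2 + D)%N.

Definition next_parts D p : seq (coloured_part n) :=
  [seq ((p.1 + ndist p.2 u + d)%N, u) | u : 'I_n.+1 <- enum 'I_n.+1, d : nat <- iota 0 D.+1].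

Fixpoint walks D p L : seq (seq (coloured_part n)) :=
  if L is L'.+1 then [seq p' :: l | p' <- next_parts D p, l <- walks D p' L']
  else [:: [::]].

Lemma mem_next_parts D p p' : (p' \in next_parts D p) = gap_le D p p'.
Proof.
apply/allpairsP/idP => [[[u d] [_]]|/andP[lo hi]].
  by rewrite mem_iota => /andP[_ dD] ->; rewrite /gap_le /=; move: dD; rewrite /=; lia.
exists (p'.2, (p'.1 - (p.1 + ndist p.2 p'.2))%N); split.
- by rewrite mem_enum.
- by rewrite mem_iota /=; lia.
- by rewrite /= subnKC // -surjective_pairing.
Qed.

Lemma uniq_next_parts D p : uniq (next_parts D p).
Proof.
apply: allpairs_uniq; rewrite ?enum_uniq ?iota_uniq //.
by move=> [u d] [u' d'] _ _ /= [+ E]; rewrite -E => /addnI ->.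
Qed.

Lemma mem_walks D p L l :
  (l \in walks D p L) = (size l == L) && path (gap_le D) p l.
Proof.
elim: L p l => [|L IHL] p l; first by rewrite inE; case: l.
apply/allpairsPdep/idP => [[p' [t [p'N tW ->]]]|].
  by rewrite /= eqSS -mem_next_parts p'N -IHL.
case: l => // p' t; rewrite /= eqSS => /and3P[st gp pt]; exists p', t.
by rewrite mem_next_parts gp IHL st pt.
Qed.

Lemma uniq_walks D p L : uniq (walks D p L).
Proof.
elim: L p => //= L IHL p; apply: allpairs_uniq_dep; first exact: uniq_next_parts.
  by move=> p' _; apply: IHL.
by move=> [p1 l1] [p2 l2] _ _ /= [-> ->].
Qed.

Lemma weight_cons p l : weight (p :: l) = (p.1 + weight l)%N.
Proof. by rewrite /weight big_cons. Qed.

(** The starting value [p.1] is carried into each of the L later parts, whence the power of q in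
    front. *)
Lemma walks_gf D p L :
  \sum_(l <- walks D p L) fpsX int ^+ weight l
  = fpsX int ^+ (L * p.1) * walk_gf n D L p.2.
Proof.
elim: L p => [|L IHL] p; first by rewrite big_seq1 /weight big_nil mul0n mulr1.
rewrite /= big_allpairs_dep /=.
under eq_bigr => p' _.
  under eq_bigr do rewrite weight_cons exprD.
  rewrite -mulr_sumr IHL mulrA -exprD -mulSn; over.
rewrite big_allpairs_dep /= big_enum [X in _ = _ * (_ * X)]big_mkord !mulr_sumr.
apply: eq_bigr => u _; rewrite mulrCA mulr_suml; apply: eq_bigr => d _ /=.
by rewrite !mulrA -!exprD; congr (_ ^+ _ * _); lia.
Qed.

Lemma count_walks D p L m :
  (count (fun l => weight l == m) (walks D p L))%:Z
  = fcoef (fpsX int ^+ (L * p.1) * walk_gf n D L p.2) m.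
Proof.
rewrite -walks_gf; elim: (walks D p L) => [|l s IHs]; first by rewrite big_nil.
rewrite big_cons fcoefD -IHs -[fpsX int ^+ _]mulr1 fcoefXnM fcoef1 /=.
by case: ltngtP; lia.
Qed.

(** Undoes the padding by initial copies of [p]. *)
Definition strip p l := drop (find (predC1 p) l) l.

Lemma stripK p l : nseq (size l - size (strip p l)) p ++ strip p l = l.
Proof.
elim: l => //= x l IHl; rewrite /strip /=; case: eqVneq => [->|_] /=.
  have le : (size (strip p l) <= size l)%N by rewrite size_drop leq_subr.
  by rewrite -/(strip p l) subSn //= IHl.
by rewrite subnn.
Qed.

Lemma ohead_strip p l : ohead (strip p l) <> Some p.
Proof.
rewrite /strip; elim: l => //= x l IHl; case: eqVneq => //= xp.
by case=> E; rewrite E eqxx in xp.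
Qed.

Lemma strip_nseq p k l : ohead l <> Some p -> strip p (nseq k p ++ l) = l.
Proof.
rewrite /strip => lp; elim: k => [|k IHk] /=; last by rewrite eqxx.
by case: l lp => //= x l xp; case: eqVneq => // E; rewrite E in xp.
Qed.

Lemma weight_nseq k i l : weight (nseq k (0%N, i) ++ l) = weight l.
Proof. by elim: k => //= k IHk; rewrite weight_cons. Qed.

Lemma path_gap_nseq D k i l :
  path (gap_le D) (0%N, i) (nseq k (0%N, i) ++ l) = path (gap_le D) (0%N, i) l.
Proof. by elim: k => //= k ->; rewrite /gap_le /ndist /= subnn. Qed.

(** A first part other than 0_{c_i} is positive, since a change of colour costs at least 1, and
    values never decrease along the walk. So every part contributes at least 1 to the weight. *)
Lemma path_size_weight D i l : path (gap_le D) (0%N, i) l ->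
  ohead l <> Some (0%N, i) -> (size l <= weight l)%N.
Proof.
have pos p t : path (gap_le D) p t -> (0 < p.1)%N -> (size t <= weight t)%N.
  elim: t p => //= p' t IHt p /andP[/andP[pp' _] /IHt pt] p0.
  by rewrite weight_cons; have := pt; lia.
case: l => //= p t /andP[/andP[lo _] pt] pi; rewrite weight_cons.
have p0 : (0 < p.1)%N.
  case: p lo pi {pt} => [[|k] u] //=; rewrite /ndist => lo [].
  by congr (Some (_, _)); apply: val_inj => /=; lia.
by have := pos _ _ pt p0; lia.
Qed.

(** Padding with copies of 0_{c_i} up to length L is a bijection onto walks of L steps and weight m;
    there is room for it because a stripped walk has at most m <= L parts. *)
Lemma card_walks D i m L (A : set (seq (coloured_part n))) : (m <= L)%N ->
  (forall l, A l <-> exists t, [/\ l = rev ((0%N, i) :: t), weight t = m,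
     path (gap_le D) (0%N, i) t & ohead t <> Some (0%N, i)]) ->
  (#|` fset_set A|)%:Z = fcoef (walk_gf n D L i) m.
Proof.
move=> mL AE; have := @count_walks D (0%N, i) L m; rewrite muln0 mul1r => <-.
pose g l := rev ((0%N, i) :: strip (0%N, i) l).
pose s := [seq g l | l <- walks D (0%N, i) L & weight l == m].
have gw l : l \in walks D (0%N, i) L -> weight l == m -> A (g l).
  rewrite mem_walks => /andP[_ pl] /eqP wl; apply/AE; exists (strip (0%N, i) l).
  rewrite -(stripK (0%N, i) l) path_gap_nseq in pl.
  rewrite -(stripK (0%N, i) l) weight_nseq in wl.
  by split=> //; apply: ohead_strip.
have As : A = [set` s]%classic.
  apply/seteqP; split=> l /=.
    move=> /AE[t [-> wt pt ot]]; apply/mapP.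
    exists (nseq (L - size t) (0%N, i) ++ t); last by rewrite /g strip_nseq.
    rewrite mem_filter weight_nseq wt eqxx mem_walks path_gap_nseq pt.
    rewrite size_cat size_nseq subnK ?eqxx //.
    by apply: leq_trans (path_size_weight pt ot) _; rewrite wt.
  by move=> /mapP[t]; rewrite mem_filter => /andP[wt tW] ->; apply: gw.
have us : uniq s.
  (* All walks have length L, so the stripped walk determines how many copies were removed. *)
  rewrite map_inj_in_uniq ?filter_uniq ?uniq_walks // => l l'.
  rewrite !mem_filter !mem_walks => /and3P[_ /eqP sl _] /and3P[_ /eqP sl' _].
  rewrite /g !rev_cons => /rcons_inj[/(can_inj revK) E].
  by rewrite -(stripK (0%N, i) l) -(stripK (0%N, i) l') E sl sl'.
have -> : fset_set A = [fset l in s]%fset.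
  by apply/fsetP => l; rewrite As in_fset_set ?inE ?mem_setE //; apply: finite_seq.
by rewrite card_fseq undup_id // size_map size_filter.
Qed.

Lemma last_part_rev_cons l i : last_part l = Some (0%N, i) ->
  exists t, l = rev ((0%N, i) :: t).
Proof.
rewrite /last_part => E; exists (behead (rev l)); rewrite -[LHS]revK.
by congr (rev _); case: (rev l) E => //= p t [->].
Qed.

Lemma weight_rev l : weight (rev l) = weight l.
Proof. by rewrite /weight; apply/perm_big; rewrite perm_rev. Qed.

Lemma penultimate_part_rev p l : penultimate_part (rev (p :: l)) = ohead l.
Proof. by rewrite /penultimate_part revK; case: l. Qed.

Lemma C_setE i m l : C_set i m l <-> exists t, [/\ l = rev ((0%N, i) :: t),
  weight t = m, path (gap_le 0) (0%N, i) t & ohead t <> Some (0%N, i)].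
Proof.
have gapE : (fun p p' => eq_gap p' p) =2 gap_le 0.
  by move=> p p'; rewrite /eq_gap /colour_gap /gap_le /ndist; lia.
split.
  case=> -[_ sl] wl /last_part_rev_cons[t tE] pen; exists t; subst l.
  rewrite weight_rev weight_cons in wl; rewrite rev_sorted in sl.
  rewrite (eq_sorted gapE) in sl; split=> // ot.
  by have := pen (0%N, i); rewrite penultimate_part_rev => /(_ ot); apply.
case=> t [-> wt pt ot]; split.
- split; first by rewrite rev_cons; case: (rev t).
  by rewrite rev_sorted (eq_sorted gapE).
- by rewrite weight_rev weight_cons.
- by rewrite /last_part revK.
(* With equality of gaps, a penultimate part of colour c_i would have value 0 and be 0_{c_i}
   itself. *)
move=> p; rewrite penultimate_part_rev => pt' pi; apply: ot; rewrite pt'.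
case: t pt' pt {wt} => //= p' t [->] /andP[+ _]; case: p pi => k u /= ->.
by rewrite /gap_le /ndist /= subnn => ?; congr (Some (_, _)); lia.
Qed.

Lemma C_ge_setE i m l : C_ge_set i m l <-> exists t, [/\ l = rev ((0%N, i) :: t),
  weight t = m, path (gap_le m) (0%N, i) t & ohead t <> Some (0%N, i)].
Proof.
split.
  case=> -[_ sl] wl /last_part_rev_cons[t tE] pen; exists t; subst l.
  rewrite weight_rev weight_cons in wl; rewrite rev_sorted in sl.
  split=> //; last first.
    by move=> ot; have := pen (0%N, i); rewrite penultimate_part_rev => /(_ ot); apply.
  (* No part of a partition of m exceeds m, so the bound m on the surpluses excludes nothing. *)
  apply: (sub_in_path (P := [pred p : coloured_part n | p.1 <= m]%N)) sl.
    move=> p p' _; rewrite inE => p'm.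
    by rewrite /ge_gap /colour_gap /gap_le /ndist; lia.
  apply/allP => p; rewrite !inE => /predU1P[->//|pt].
  by rewrite -wl /weight (big_rem p) //= leq_addr.
case=> t [-> wt pt ot]; split.
- split; first by rewrite rev_cons; case: (rev t).
  rewrite rev_sorted /=; apply: sub_path pt => p p'.
  by rewrite /ge_gap /colour_gap /gap_le /ndist; lia.
- by rewrite weight_rev weight_cons.
- by rewrite /last_part revK.
by move=> p; rewrite penultimate_part_rev => op pi; apply: ot; rewrite op pi.
Qed.

End Walks.

Theorem theorem1p6 (n : nat) (i : 'I_n.+1) :
  let q : fps int := fpsX int in
  Fps (fun m => (C_num i m)%:Z) =
    qpochs_inf [:: q ^+ (i + 1); q ^+ (n - i + 1); q ^+ (n + 2)] (q ^+ (n + 2))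
    / (qpoch_inf q (q ^+ 2) * qpoch_inf q q)
  /\
  Fps (fun m => (C_ge_num i m)%:Z) =
    qpochs_inf [:: q ^+ (i + 1); q ^+ (n - i + 1); q ^+ (n + 2)] (q ^+ (n + 2))
    / (qpoch_inf q (q ^+ 2) * qpoch_inf q q ^+ 2).
Proof.
have i_n : (i <= n)%N by rewrite -ltnS ltn_ord.
move=> q; split; apply: fpsP => m.
  (* Walks of m steps determine the series modulo X^(m+1), which includes the coefficient of q^m. *)
  rewrite -(@walk_gf_lim n m i i_n m) //.
  by apply: card_walks => // l; apply: C_setE.
rewrite -(@walk_gf_surplus_lim n m m i i_n (leqnn m) m) //.
by apply: card_walks => // l; apply: C_ge_setE.
Qed.
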